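(* For a $T_0$ space $X$ the following are equivalent: (1) $X$ is locally compact and sober. (2) $X$ is locally compact and well-filtered. (3) $X$ is core compact and sober. (4) $X$ is core compact and well-filtered.
   Context: A space is sober if every irreducible closed set (a nonempty closed set not contained in the union of two closed sets unless contained in one of them) is the closure of a unique point. Specialization order $x\le y$ iff $x\in\overline{\{y\}}$; saturated = upper set; $\mathsf{K}(X)$ = nonempty compact saturated subsets. Well-filtered: $T_0$ and for every open $U$ and every $\mathcal K\subseteq\mathsf{K}(X)$ filtered under inclusion, $\bigcap\mathcal K\subseteq U$ implies some $K\in\mathcal K$ lies in $U$. Locally compact: every point has a neighborhood base of compact sets. Core compact: the lattice of open sets is a continuous lattice. *)

(* Defs.v *)
From Stdlib Require Import List.

Definition set (X : Type) := X -> Prop.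

Section Topology.
Context {X : Type}.

Record is_topology (op : set X -> Prop) : Prop := {
  top_full  : op (fun _ => True);
  top_inter : forall U V, op U -> op V -> op (fun x => U x /\ V x);
  top_union : forall F : set (set X), (forall U, F U -> op U) ->
                op (fun x => exists U, F U /\ U x)
}.

Definition subset (A B : set X) : Prop := forall x, A x -> B x.

Definition set_eq (A B : set X) : Prop := forall x, A x <-> B x.

Definition closed (op : set X -> Prop) (C : set X) : Prop := op (fun x => ~ C x).

Definition closure (op : set X -> Prop) (A : set X) : set X :=
  fun x => forall C, closed op C -> subset A C -> C x.

Definition T0 (op : set X -> Prop) : Prop :=
  forall x y, (forall U, op U -> (U x <-> U y)) -> x = y.

Definition spec_le (op : set X -> Prop) (x y : X) : Prop :=
  closure op (fun z => z = y) x.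

Definition irreducible_closed (op : set X -> Prop) (A : set X) : Prop :=
  closed op A /\ (exists x, A x) /\
  forall C1 C2, closed op C1 -> closed op C2 ->
    subset A (fun x => C1 x \/ C2 x) -> subset A C1 \/ subset A C2.

Definition sober (op : set X -> Prop) : Prop :=
  forall A, irreducible_closed op A ->
    exists x, set_eq A (closure op (fun z => z = x)) /\
      forall y, set_eq A (closure op (fun z => z = y)) -> y = x.

Definition saturated (op : set X -> Prop) (A : set X) : Prop :=
  forall x y, A x -> spec_le op x y -> A y.

Definition compact (op : set X -> Prop) (K : set X) : Prop :=
  forall F : set (set X), (forall U, F U -> op U) ->
    subset K (fun x => exists U, F U /\ U x) ->
    exists l : list (set X), (forall U, In U l -> F U) /\
      subset K (fun x => exists U, In U l /\ U x).

Definition in_KX (op : set X -> Prop) (K : set X) : Prop :=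
  (exists x, K x) /\ compact op K /\ saturated op K.

Definition filtered (KK : set (set X)) : Prop :=
  (exists K, KK K) /\
  forall K1 K2, KK K1 -> KK K2 ->
    exists K3, KK K3 /\ subset K3 K1 /\ subset K3 K2.

Definition well_filtered (op : set X -> Prop) : Prop :=
  T0 op /\
  forall (U : set X) (KK : set (set X)), op U ->
    (forall K, KK K -> in_KX op K) -> filtered KK ->
    subset (fun x => forall K, KK K -> K x) U ->
    exists K, KK K /\ subset K U.

Definition locally_compact (op : set X -> Prop) : Prop :=
  forall (x : X) (U : set X), op U -> U x ->
    exists K V, compact op K /\ op V /\ V x /\ subset V K /\ subset K U.

Definition directed (F : set (set X)) : Prop :=
  (exists U, F U) /\
  forall U1 U2, F U1 -> F U2 ->
    exists U3, F U3 /\ subset U1 U3 /\ subset U2 U3.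

(* way-below relation in the complete lattice of open sets
   (joins are unions) *)
Definition way_below (op : set X -> Prop) (U V : set X) : Prop :=
  forall F : set (set X), (forall W, F W -> op W) -> directed F ->
    subset V (fun x => exists W, F W /\ W x) ->
    exists W, F W /\ subset U W.

(* lattice of opens is continuous: every open is the join of the
   opens way below it *)
Definition core_compact (op : set X -> Prop) : Prop :=
  forall V, op V ->
    set_eq V (fun x => exists U, op U /\ way_below op U V /\ U x).

End Topology.

(* Main.v *)
From Stdlib Require Import List Lia.
From mathcomp Require boolp classical_sets.
Require Import Defs.

(** The two substantial facts are that sober spaces are well-filtered and that
    a core compact well-filtered space is locally compact and sober.  Both use
    a Zorn argument: an open set containing no member of a suitable family
    [D] extends to a maximal such open set [W], i.e. the complement of [W] is
    a minimal closed set meeting every member of [D].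

    If [D] is a filtered family of compact saturated sets, minimality makes the
    complement of [W] irreducible, and in a sober space its generic point lies in
    every member of [D].

    If [D] consists of open sets [u 0 >> u 1 >> ...], pick [x n] in [u n] outside
    [W]; by maximality every open set containing one of these points contains
    almost all of them, so the upper closures of the tails are compact, and
    well-filteredness yields that any open set containing the intersection of
    the [u n] contains some [u n].  Hence this intersection is compact, and
    interpolating the way-below relation gives local compactness.  Sobriety
    follows by applying well-filteredness to the compact saturated sets whose
    interior meets a given irreducible closed set. *)

(** * Classical and topological preliminaries *)

Lemma not_subset_witness {X : Type} (A B : set X) :
  ~ subset A B -> exists x, A x /\ ~ B x.
Proof.
  intros H. apply boolp.contrapT. intros Hn. apply H. intros x Ax.
  apply boolp.contrapT. intros Bx. apply Hn. exists x. tauto.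
Qed.

Lemma open_ext {X : Type} (op : set X -> Prop) (U V : set X) :
  set_eq U V -> op U -> op V.
Proof. intros E. rewrite (proj2 (boolp.predeqP U V) E). trivial. Qed.

Lemma open_empty {X : Type} (op : set X -> Prop) :
  is_topology op -> op (fun _ => False).
Proof.
  intros Ht. eapply open_ext; [|apply (top_union _ Ht (fun _ => False)); tauto].
  intros x. split; [intros [U [[] _]] | tauto].
Qed.

Lemma open_union2 {X : Type} (op : set X -> Prop) (U V : set X) :
  is_topology op -> op U -> op V -> op (fun x => U x \/ V x).
Proof.
  intros Ht HU HV.
  eapply open_ext; [|apply (top_union _ Ht (fun W => W = U \/ W = V))].
  - intros x. split.
    + intros [W [[-> | ->] Wx]]; tauto.
    + intros [H | H]; eauto.
  - intros W [-> | ->]; assumption.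
Qed.

Lemma closed_compl {X : Type} (op : set X -> Prop) (U : set X) :
  op U -> closed op (fun x => ~ U x).
Proof.
  apply (open_ext op). intros x. split; [tauto | apply boolp.contrapT].
Qed.

Lemma spec_leP {X : Type} (op : set X -> Prop) (x y : X) :
  spec_le op x y <-> (forall U, op U -> U x -> U y).
Proof.
  split.
  - intros H U HU Ux. apply boolp.contrapT. intros Uy.
    apply (H (fun z => ~ U z)); [now apply closed_compl | now intros z -> | exact Ux].
  - intros H C HC Cy. apply boolp.contrapT. intros Cx.
    apply (H _ HC Cx). now apply Cy.
Qed.

(** * Compactness through directed covers *)

Definition finite_unions {X : Type} (F : set (set X)) : set (set X) :=
  fun W => exists l, (forall U, In U l -> F U) /\
                     W = (fun x => exists U, In U l /\ U x).

Lemma finite_unions_open {X : Type} (op : set X -> Prop) (F : set (set X)) :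
  is_topology op -> (forall U, F U -> op U) ->
  forall W, finite_unions F W -> op W.
Proof.
  intros Ht HF W [l [Hl ->]].
  apply (top_union _ Ht (fun U => In U l)). auto.
Qed.

Lemma finite_unions_directed {X : Type} (F : set (set X)) :
  directed (finite_unions F).
Proof.
  split.
  - exists (fun x => exists U, In U nil /\ U x). exists nil. split; [now intros U [] | reflexivity].
  - intros U1 U2 [l1 [H1 ->]] [l2 [H2 ->]].
    exists (fun x => exists U, In U (l1 ++ l2) /\ U x). split; [|split].
    + exists (l1 ++ l2). split; [|reflexivity].
      intros U HU. apply in_app_or in HU. destruct HU; auto.
    + intros x [U [HU Ux]]. exists U. split; [apply in_or_app|]; auto.
    + intros x [U [HU Ux]]. exists U. split; [apply in_or_app|]; auto.
Qed.

Lemma directed_upper_bound {X : Type} (F : set (set X)) (l : list (set X)) :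
  directed F -> (forall U, In U l -> F U) ->
  exists W, F W /\ subset (fun x => exists U, In U l /\ U x) W.
Proof.
  intros [[U0 HU0] HF]. induction l as [|V l IH]; intros Hl.
  - exists U0. split; [assumption|]. now intros x [U [[] _]].
  - destruct IH as [W [HW HlW]]; [intros; apply Hl; now right|].
    destruct (HF V W) as [W' [HW' [VW' WW']]]; [apply Hl; now left | assumption|].
    exists W'. split; [assumption|]. intros x [U [[<- | HU] Ux]].
    + now apply VW'.
    + apply WW', HlW. eauto.
Qed.

(** A finite part of a directed family is bounded by one member; conversely, any cover can be
    replaced by its directed family of finite unions. The right-hand side is [way_below op K K]
    unfolded. *)
Lemma compactP {X : Type} (op : set X -> Prop) (K : set X) :
  is_topology op ->
  compact op K <->
  (forall F : set (set X), (forall W, F W -> op W) -> directed F ->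
     subset K (fun x => exists W, F W /\ W x) ->
     exists W, F W /\ subset K W).
Proof.
  intros Ht. split.
  - intros HK F HF dF KF. destruct (HK F HF KF) as [l [Hl Kl]].
    destruct (directed_upper_bound F l dF Hl) as [W [FW lW]].
    exists W. split; [assumption|]. intros x Kx. apply lW, Kl, Kx.
  - intros HK F HF KF.
    destruct (HK (finite_unions F)) as [W [[l [Hl ->]] KW]].
    + now apply finite_unions_open.
    + apply finite_unions_directed.
    + intros x Kx. destruct (KF x Kx) as [U [FU Ux]].
      exists (fun y => exists V, In V (U :: nil) /\ V y). split.
      * exists (U :: nil). split; [|reflexivity]. now intros V [<- | []].
      * exists U. split; [now left | assumption].
    + exists l. auto.
Qed.

(** * Saturations and the specialization order *)

Definition saturation {X : Type} (op : set X -> Prop) (A : set X) : set X :=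
  fun y => exists x, A x /\ spec_le op x y.

Lemma subset_saturation {X : Type} (op : set X -> Prop) (A : set X) :
  subset A (saturation op A).
Proof. intros x Ax. exists x. split; [assumption | now apply spec_leP]. Qed.

Lemma saturation_subset_open {X : Type} (op : set X -> Prop) (A U : set X) :
  op U -> subset A U -> subset (saturation op A) U.
Proof.
  intros HU AU y [x [Ax xy]]. apply (proj1 (spec_leP op x y) xy U HU). auto.
Qed.

Lemma saturation_saturated {X : Type} (op : set X -> Prop) (A : set X) :
  saturated op (saturation op A).
Proof.
  intros y z [x [Ax xy]] yz. exists x. split; [assumption|].
  apply spec_leP. intros U HU Ux.
  apply (proj1 (spec_leP op y z) yz U HU), (proj1 (spec_leP op x y) xy U HU), Ux.
Qed.

(** A set and its saturation lie in the same open sets, so a finite subcover of [K] already covers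
    the saturation. *)
Lemma saturation_compact {X : Type} (op : set X -> Prop) (K : set X) :
  is_topology op -> compact op K -> compact op (saturation op K).
Proof.
  intros Ht HK F HF KF. destruct (HK F HF) as [l [Hl Kl]].
  - intros x Kx. apply KF, subset_saturation, Kx.
  - exists l. split; [assumption|]. apply saturation_subset_open; [|assumption].
    apply (top_union _ Ht (fun U => In U l)). auto.
Qed.

(** * The way-below relation and core compactness *)

Lemma way_below_subset {X : Type} (op : set X -> Prop) (U V : set X) :
  op V -> way_below op U V -> subset U V.
Proof.
  intros HV H. destruct (H (fun W => W = V)) as [W [-> HUV]].
  - now intros W ->.
  - split; [now exists V|]. intros U1 U2 -> ->. exists V. unfold subset. auto.
  - intros x Vx. eauto.
  - assumption.
Qed.

Lemma way_below_mono_l {X : Type} (op : set X -> Prop) (U U' V : set X) :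
  subset U U' -> way_below op U' V -> way_below op U V.
Proof.
  intros UU' H F HF dF VF. destruct (H F HF dF VF) as [W [FW U'W]].
  exists W. split; [assumption|]. intros x Ux. auto.
Qed.

Lemma way_below_union {X : Type} (op : set X -> Prop) (U1 U2 V1 V2 : set X) :
  way_below op U1 V1 -> way_below op U2 V2 ->
  way_below op (fun x => U1 x \/ U2 x) (fun x => V1 x \/ V2 x).
Proof.
  intros H1 H2 F HF dF VF.
  destruct (H1 F HF dF) as [W1 [F1 UW1]]; [intros x Vx; apply VF; now left|].
  destruct (H2 F HF dF) as [W2 [F2 UW2]]; [intros x Vx; apply VF; now right|].
  destruct (proj2 dF W1 W2 F1 F2) as [W [FW [W1W W2W]]].
  exists W. split; [assumption|]. intros x [Ux | Ux]; auto.
Qed.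

Lemma way_below_empty {X : Type} (op : set X -> Prop) (V : set X) :
  way_below op (fun _ => False) V.
Proof. intros F _ [[W FW] _] _. exists W. split; [assumption | now intros x []]. Qed.

(** Test [V << U] against the opens [W] with [W << W' << U] for some open [W']. They are directed,
    being closed under binary unions, and they cover [U] by core compactness applied twice; the [W']
    of a member containing [V] interpolates. *)
Lemma way_below_interpolation {X : Type} (op : set X -> Prop) (V U : set X) :
  is_topology op -> core_compact op -> op U -> way_below op V U ->
  exists W, op W /\ way_below op V W /\ way_below op W U.
Proof.
  intros Ht Hc HU VU.
  destruct (VU (fun W => op W /\
      exists W', op W' /\ way_below op W W' /\ way_below op W' U))
    as [W [[_ [W' [HW' [WW' W'U]]]] VW]].
  - now intros W [HW _].
  - split.
    + exists (fun _ => False). split; [now apply open_empty|].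
      exists (fun _ => False). split; [now apply open_empty|].
      split; apply way_below_empty.
    + intros A B [HA [A' [HA' [AA' A'U]]]] [HB [B' [HB' [BB' B'U]]]].
      exists (fun x => A x \/ B x). split; [|unfold subset; auto].
      split; [now apply open_union2|].
      exists (fun x => A' x \/ B' x). split; [now apply open_union2|].
      split; [now apply way_below_union|].
      intros F HF dF UF. apply (way_below_union op A' B' U U A'U B'U F HF dF).
      intros x [Ux | Ux]; now apply UF.
  - intros x Ux. destruct (proj1 (Hc U HU x) Ux) as [W' [HW' [W'U W'x]]].
    destruct (proj1 (Hc W' HW' x) W'x) as [W [HW [WW' Wx]]].
    exists W. eauto 6.
  - exists W'. split; [assumption|]. split; [|assumption].
    now apply way_below_mono_l with W.
Qed.

(** A compact set squeezed between [U] and [V] forces [U << V]. *)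
Lemma locally_compact_core_compact {X : Type} (op : set X -> Prop) :
  is_topology op -> locally_compact op -> core_compact op.
Proof.
  intros Ht Hl V HV x. split.
  - intros Vx. destruct (Hl x V HV Vx) as [K [U [HK [HU [Ux [UK KV]]]]]].
    exists U. split; [assumption|]. split; [|assumption].
    intros F HF dF VF.
    destruct (proj1 (compactP op K Ht) HK F HF dF) as [W [FW KW]].
    + intros y Ky. apply VF, KV, Ky.
    + exists W. split; [assumption|]. intros y Uy. auto.
  - intros [U [_ [UV Ux]]]. exact (way_below_subset op U V HV UV x Ux).
Qed.

(** * Maximal open sets from Zorn's lemma *)

Lemma maximal_open_avoiding {X : Type} (op : set X -> Prop)
  (D : set (set X)) (U : set X) :
  is_topology op -> op U ->
  (forall F K, (forall W, F W -> op W) -> directed F -> D K ->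
     subset K (fun x => exists W, F W /\ W x) ->
     exists K' W, D K' /\ F W /\ subset K' W) ->
  (forall K, D K -> ~ subset K U) ->
  exists W, op W /\ subset U W /\ (forall K, D K -> ~ subset K W) /\
    forall V, op V -> ~ subset V W ->
      exists K, D K /\ subset K (fun x => W x \/ V x).
Proof.
  intros Ht HU HD DU.
  set (P := fun W => op W /\ subset U W /\ forall K, D K -> ~ subset K W).
  assert (PU : P U) by (split; [|split]; unfold subset; auto).
  destruct (@classical_sets.ZL_preorder {W | P W} (exist P U PU)
     (fun a b => boolp.asbool (subset (proj1_sig a) (proj1_sig b))))
    as [[W PW] HW].
  - intros a. apply boolp.asboolT. unfold subset. auto.
  - intros b a c Hab Hbc. apply boolp.asboolW in Hab, Hbc. apply boolp.asboolT.
    unfold subset in *. auto.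
  - intros A totA.
    destruct (boolp.EM (exists a, A a)) as [[a Aa] | An].
    (* The union of the empty chain need not contain [U], so [U] itself is the bound. *)
    2: { exists (exist P U PU). intros s As. exfalso. eauto. }
    set (F := fun W => exists a, A a /\ W = proj1_sig a).
    assert (Fop : forall W, F W -> op W).
    { intros W [s [_ ->]]. exact (proj1 (proj2_sig s)). }
    assert (dF : directed F).
    { split; [exists (proj1_sig a), a; auto|].
      intros W1 W2 [s [As ->]] [t [At ->]].
      destruct (totA s t As At) as [H | H]; apply boolp.asboolW in H.
      - exists (proj1_sig t). split; [exists t; auto|]. unfold subset in *. auto.
      - exists (proj1_sig s). split; [exists s; auto|]. unfold subset in *. auto. }
    assert (PF : P (fun x => exists W, F W /\ W x)).
    { split; [now apply (top_union _ Ht)|]. split.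
      - intros x Ux. exists (proj1_sig a). split; [exists a; auto|].
        now apply (proj1 (proj2 (proj2_sig a))).
      (* [HD] puts some [K'] of [D] inside a single member of the chain. For compact sets [K'] is
         [K]; for a way-below chain it is the next term. *)
      - intros K DK KF.
        destruct (HD F K Fop dF DK KF) as [K' [W [DK' [[s [_ ->]] K'W]]]].
        exact (proj2 (proj2 (proj2_sig s)) K' DK' K'W). }
    exists (exist P _ PF). intros s As. apply boolp.asboolT.
    intros x sx. exists (proj1_sig s). split; [exists s; auto | assumption].
  - exists W. destruct PW as [opW [UW DW]].
    split; [assumption|]. split; [assumption|]. split; [assumption|].
    intros V HV VW. apply boolp.contrapT. intros Hn.
    assert (PV : P (fun x => W x \/ V x)).
    { split; [now apply open_union2|]. split.
      - intros x Ux. left. now apply UW.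
      - intros K DK KV. apply Hn. eauto. }
    assert (H := HW (exist P _ PV)). simpl in H.
    apply VW. assert (H' : subset (fun x => W x \/ V x) W).
    { eapply boolp.asboolW, H. apply boolp.asboolT. intros x Wx. now left. }
    intros x Vx. apply H'. now right.
Qed.

(** * Sober spaces are well-filtered *)

Lemma sober_well_filtered {X : Type} (op : set X -> Prop) :
  is_topology op -> T0 op -> sober op -> well_filtered op.
Proof.
  intros Ht HT Hs. split; [assumption|].
  intros U KK HU HKK [[K0 HK0] KKf] KU. apply boolp.contrapT. intros Hn.
  destruct (maximal_open_avoiding op KK U Ht HU) as [W [HW [UW [KW Wmax]]]].
  - intros F K HF dF KKK KF. destruct (HKK K KKK) as [_ [Kc _]].
    destruct (proj1 (compactP op K Ht) Kc F HF dF KF) as [V [FV KV]]. eauto.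
  - intros K KKK KKU. eauto.
  - destruct (Hs (fun x => ~ W x)) as [x [Hx _]].
    + split; [now apply closed_compl|]. split.
      { destruct (not_subset_witness K0 W (KW K0 HK0)) as [x [_ Wx]]. eauto. }
      (* If neither closed set contains the complement of [W], maximality gives [K1] and [K2] inside
         [W] joined with the complement of [C1], resp. [C2]. A common lower bound [K3] then lies in
         [W]. *)
      intros C1 C2 HC1 HC2 HC. apply boolp.contrapT. intros HCn.
      destruct (Wmax _ HC1) as [K1 [HK1 KW1]].
      { intros H. apply HCn. left. intros x Wx. apply boolp.contrapT. auto. }
      destruct (Wmax _ HC2) as [K2 [HK2 KW2]].
      { intros H. apply HCn. right. intros x Wx. apply boolp.contrapT. auto. }
      destruct (KKf K1 K2 HK1 HK2) as [K3 [HK3 [K31 K32]]].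
      apply (KW K3 HK3). intros x Kx. apply boolp.contrapT. intros Wx.
      destruct (HC x Wx), (KW1 x (K31 x Kx)), (KW2 x (K32 x Kx)); auto.
    + assert (Wx : ~ W x) by (apply Hx; intros C _ HC; now apply HC).
      (* Each [K] has a point [y] outside [W]; [y] is below the generic point [x], so saturation
         puts [x] in [K]. *)
      apply Wx, UW, KU. intros K HK.
      destruct (not_subset_witness K W (KW K HK)) as [y [Ky Wy]].
      apply (proj2 (proj2 (HKK K HK)) y x Ky). now apply Hx.
Qed.

(** * Core compact well-filtered spaces are locally compact *)

Lemma descending_mono {X : Type} (u : nat -> set X) :
  (forall n, subset (u (S n)) (u n)) ->
  forall m n, m <= n -> subset (u n) (u m).
Proof.
  intros Hu m n H. induction H as [|n _ IH]; unfold subset in *; auto.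
Qed.

(** The member of a cover that contains [x n] contains almost all of the sequence; finitely many
    further members handle the remaining terms. *)
Lemma tail_saturation_compact {X : Type} (op : set X -> Prop) (x : nat -> X) (n : nat) :
  is_topology op ->
  (forall V k, op V -> V (x k) -> exists m, forall j, m <= j -> V (x j)) ->
  compact op (saturation op (fun y => exists k, n <= k /\ y = x k)).
Proof.
  intros Ht Hx. apply saturation_compact; [assumption|]. intros F HF KF.
  destruct (KF (x n)) as [V [FV Vx]]; [eauto|].
  destruct (Hx V n (HF V FV) Vx) as [m Hm].
  assert (Hinit : forall j, exists l, (forall U, In U l -> F U) /\
             forall k, n <= k < j -> exists U, In U l /\ U (x k)).
  { induction j as [|j [l [Hl IH]]].
    - exists nil. split; [now intros U [] | lia].
    - destruct (Compare_dec.le_lt_dec n j) as [nj | jn].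
      + destruct (KF (x j)) as [U [FU Ux]]; [eauto|].
        exists (U :: l). split; [intros U' [<- | H]; auto|].
        intros k Hk. destruct (PeanoNat.Nat.eq_dec k j) as [-> | kj].
        * exists U. split; [now left | assumption].
        * destruct (IH k) as [U' [H1 H2]]; [lia|]. exists U'. split; [now right | assumption].
      + exists l. split; [assumption|]. intros k Hk. lia. }
  destruct (Hinit m) as [l [Hl Hlm]]. exists (V :: l). split.
  - intros U [<- | H]; auto.
  - intros y [k [nk ->]]. destruct (Compare_dec.le_lt_dec m k) as [mk | km].
    + exists V. split; [now left | auto].
    + destruct (Hlm k) as [U [H1 H2]]; [lia|]. exists U. split; [now right | assumption].
Qed.

Lemma well_filtered_way_below_chain {X : Type} (op : set X -> Prop)
  (u : nat -> set X) (U : set X) :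
  is_topology op -> well_filtered op ->
  (forall n, op (u n)) -> (forall n, way_below op (u (S n)) (u n)) ->
  op U -> subset (fun x => forall n, u n x) U ->
  exists n, subset (u n) U.
Proof.
  intros Ht [_ Hwf] Hu Hwb HU uU. apply boolp.contrapT. intros Hn.
  assert (umono := descending_mono u
            (fun n => way_below_subset op _ _ (Hu n) (Hwb n))).
  destruct (maximal_open_avoiding op (fun A => exists n, A = u n) U Ht HU)
    as [W [HW [UW [uW Wmax]]]].
  - intros F K HF dF [n ->] KF. destruct (Hwb n F HF dF KF) as [V [FV uV]].
    exists (u (S n)), V. eauto.
  - intros K [n ->] H. eauto.
  - destruct (@boolp.choice nat X (fun n x => u n x /\ ~ W x)) as [x Hx].
    { intros n. apply not_subset_witness, uW. eauto. }
    assert (Htail : forall V k, op V -> V (x k) ->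
              exists m, forall j, m <= j -> V (x j)).
    (* As [x k] is outside [W], [V] is not inside [W], so some [u m] lies in the union of [W] and
       [V]. For [j >= m], [x j] is in [u m] but not in [W], hence in [V]. *)
    { intros V k HV Vx. destruct (Wmax V HV) as [K [[m ->] KV]].
      - intros VW. apply (proj2 (Hx k)). now apply VW.
      - exists m. intros j mj. destruct (Hx j) as [uj Wj].
        destruct (KV (x j)); [now apply (umono m j) | contradiction | assumption]. }
    set (T := fun n => saturation op (fun y => exists k, n <= k /\ y = x k)).
    destruct (Hwf U (fun K => exists n, K = T n) HU) as [K [[n ->] KU]].
    + intros K [n ->]. split; [|split].
      * exists (x n). apply subset_saturation. eauto.
      * now apply tail_saturation_compact.
      * apply saturation_saturated.
    + split; [now exists (T 0), 0|]. intros K1 K2 [n ->] [m ->].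
      exists (T (n + m)). split; [eauto|].
      split; intros y [z [[k [Hk ->]] Hy]]; exists (x k);
        (split; [exists k; split; [lia | reflexivity] | assumption]).
    + intros y Hy. apply uU. intros n.
      apply (saturation_subset_open op (fun y => exists k, n <= k /\ y = x k));
        [apply Hu | | apply Hy; now exists n].
      intros z [k [nk ->]]. exact (umono n k nk _ (proj1 (Hx k))).
    (* [x n] lies in [T n], hence in [U] and in [W], against its choice. *)
    + apply (proj2 (Hx n)), UW, KU, subset_saturation. exists n. auto.
Qed.

Lemma core_compact_well_filtered_locally_compact {X : Type} (op : set X -> Prop) :
  is_topology op -> core_compact op -> well_filtered op -> locally_compact op.
Proof.
  intros Ht Hc Hwf x U HU Ux.
  destruct (proj1 (Hc U HU x) Ux) as [V [HV [VU Vx]]].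
  (* The guard makes the relation total, with default [W]; iterating [f] from [U] never leaves the
     opens that [V] is way below. *)
  destruct (@boolp.choice (set X) (set X) (fun W W' =>
      op W /\ way_below op V W ->
      (op W' /\ way_below op V W') /\ way_below op W' W)) as [f Hf].
  { intros W. destruct (boolp.EM (op W /\ way_below op V W)) as [[HW VW] | H].
    - destruct (way_below_interpolation op V W Ht Hc HW VW) as [W' [H1 [H2 H3]]].
      exists W'. auto.
    - exists W. tauto. }
  set (u := fun n => PeanoNat.Nat.iter n f U).
  assert (Hu : forall n, op (u n) /\ way_below op V (u n)).
  { induction n as [|n IH]; [now split | exact (proj1 (Hf _ IH))]. }
  assert (Hwb : forall n, way_below op (u (S n)) (u n)).
  { intros n. exact (proj2 (Hf _ (Hu n))). }
  exists (fun y => forall n, u n y), V.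
  split; [|split; [assumption | split; [assumption | split]]].
  - apply compactP; [assumption|]. intros F HF dF KF.
    (* The union of [F] contains some [u n]; since [u (S n) << u n], a single member contains
       [u (S n)], hence the intersection. *)
    destruct (well_filtered_way_below_chain op u (fun y => exists W, F W /\ W y)
                Ht Hwf (fun n => proj1 (Hu n)) Hwb) as [n Hn].
    + now apply (top_union _ Ht).
    + exact KF.
    + destruct (Hwb n F HF dF Hn) as [W [FW uW]].
      exists W. split; [assumption|]. intros y Hy. apply uW, Hy.
  - intros y Vy n. exact (way_below_subset op V (u n) (proj1 (Hu n)) (proj2 (Hu n)) y Vy).
  - intros y Hy. exact (Hy 0).
Qed.

(** * Sobriety and the equivalences *)

Lemma locally_compact_well_filtered_sober {X : Type} (op : set X -> Prop) :
  is_topology op -> locally_compact op -> well_filtered op -> sober op.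
Proof.
  intros Ht Hl [HT Hwf] A [HA [[a Aa] Airr]].
  set (KK := fun K => in_KX op K /\
               exists V y, op V /\ subset V K /\ V y /\ A y).
  assert (HKK : forall U y, op U -> U y -> A y -> exists K, KK K /\ subset K U).
  { intros U y HU Uy Ay. destruct (Hl y U HU Uy) as [K [V [HK [HV [Vy [VK KU]]]]]].
    exists (saturation op K). split; [|now apply saturation_subset_open].
    assert (VS : subset V (saturation op K)).
    { intros z Vz. apply subset_saturation. auto. }
    split; [split; [|split]|].
    - exists y. auto.
    - now apply saturation_compact.
    - apply saturation_saturated.
    - exists V, y. auto. }
  assert (Hgen : exists x, A x /\ forall K, KK K -> K x).
  { apply boolp.contrapT. intros Hn.
    destruct (Hwf (fun x => ~ A x) KK HA) as [K [[_ [V [y [_ [VK [Vy Ay]]]]]] KA]].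
    - now intros K [HK _].
    - split.
      { destruct (HKK (fun _ => True) a (top_full _ Ht) I Aa) as [K [HK _]]. eauto. }
      intros K1 K2 [_ [V1 [y1 [HV1 [VK1 [Vy1 Ay1]]]]]] [_ [V2 [y2 [HV2 [VK2 [Vy2 Ay2]]]]]].
      (* By irreducibility, two opens meeting [A] meet at a common point of [A]; otherwise their
         complements would cover [A]. *)
      destruct (boolp.EM (exists y, A y /\ V1 y /\ V2 y)) as [[y [Ay [V1y V2y]]] | Hd].
      + destruct (HKK (fun z => V1 z /\ V2 z) y) as [K [HK KV]]; auto.
        { now apply (top_inter _ Ht). }
        exists K. split; [assumption|].
        split; intros z Kz; destruct (KV z Kz); auto.
      + exfalso.
        destruct (Airr _ _ (closed_compl op V1 HV1) (closed_compl op V2 HV2)) as [H | H].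
        * intros y Ay. destruct (boolp.EM (V1 y)); [right; intros ?; eauto | now left].
        * now apply (H y1).
        * now apply (H y2).
    - intros x Hx Ax. apply Hn. eauto.
    - apply (KA y); auto. }
  destruct Hgen as [x [Ax HxK]].
  assert (E : set_eq A (closure op (fun z => z = x))).
  { intros y. split.
    (* Every open neighborhood of a point of [A] contains a member of [KK], and so contains [x]. *)
    - intros Ay. apply spec_leP. intros U HU Uy.
      destruct (HKK U y HU Uy Ay) as [K [HK KU]]. apply KU, HxK, HK.
    - intros Hy. apply Hy; [assumption | now intros z ->]. }
  exists x. split; [assumption|]. intros y Ey.
  assert (yx : spec_le op y x).
  { apply E, Ey. intros C _ HC. now apply HC. }
  assert (xy : spec_le op x y) by (apply Ey, Ax).
  apply HT. intros U HU. split.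
  - now apply (proj1 (spec_leP op y x) yx).
  - now apply (proj1 (spec_leP op x y) xy).
Qed.

Theorem mainTheorem19 (X : Type) (op : set X -> Prop)
  (Htop : is_topology op) (HT0 : T0 op) :
  ((locally_compact op /\ sober op) <-> (locally_compact op /\ well_filtered op)) /\
  ((locally_compact op /\ sober op) <-> (core_compact op /\ sober op)) /\
  ((locally_compact op /\ sober op) <-> (core_compact op /\ well_filtered op)).
Proof.
  assert (H1 := locally_compact_core_compact op Htop).
  assert (H2 := sober_well_filtered op Htop HT0).
  assert (H3 := core_compact_well_filtered_locally_compact op Htop).
  assert (H4 := locally_compact_well_filtered_sober op Htop).
  tauto.
Qed.
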